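(* Let $d\ge 1$ and let $\mathcal{T}^d$ be the space of transitive $d$-dimensional shifts. (1) If $X\in\mathcal{T}^d$ is of finite type and either has maximality type $1$ or is minimal, then $X$ is an isolated point of $\mathcal{T}^d$. (2) If $X\in\mathcal{T}^d$ is not of finite type and has maximality type $1$, then $X$ is an isolated point of $\mathcal{T}^d$ if and only if there exists a $d$-dimensional shift of finite type $Z$ such that $X\subset Z$ and $Z\setminus X$ is not dense in $Z$.
   Context: For a finite set $\mathcal{A}\subset\mathbb{Z}$, elements of $\mathcal{A}^{\mathbb{Z}^d}$ are called configurations. For configurations $x,y$ (possibly over different alphabets) set $\delta(x,y)=2^{-\inf\{\|\mathbf{n}\|_\infty : \mathbf{n}\in\mathbb{Z}^d,\ x_{\mathbf{n}}\neq y_{\mathbf{n}}\}}$ (and $\delta(x,x)=0$). The shift action is $\sigma^{\mathbf{u}}(x)_{\mathbf{v}}=x_{\mathbf{u}+\mathbf{v}}$. A $d$-dimensional shift is a nonempty compact set $X\subset\mathcal{A}^{\mathbb{Z}^d}$, for some finite $\mathcal{A}\subset\mathbb{Z}$, with $\sigma^{\mathbf{u}}(X)\subset X$ for all $\mathbf{u}\in\mathbb{Z}^d$. The set $\mathcal{S}^d$ of all $d$-dimensional shifts (over all finite alphabets $\mathcal{A}\subset\mathbb{Z}$) carries the Hausdorff metric $\delta_H(X,Z)=\max\left(\sup_{x\in X}\inf_{z\in Z}\delta(x,z),\ \sup_{z\in Z}\inf_{x\in X}\delta(z,x)\right)$. A shift is of finite type if it is the set of all configurations over some finite alphabet in which no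 pattern from some finite set of finite patterns appears. A shift $X$ is transitive if some $x\in X$ has orbit $\mathcal{O}(x)=\{\sigma^{\mathbf{u}}(x):\mathbf{u}\in\mathbb{Z}^d\}$ dense in $X$. $\mathcal{T}^d\subset\mathcal{S}^d$ is the set of transitive shifts with the induced metric. A subsystem of $X$ is a nonempty closed shift-invariant subset of $X$; it is proper if it differs from $X$. $X$ is minimal if it has no proper subsystem. A subsystem is maximal if it is proper and not contained in any other proper subsystem. The maximality type of $X$ is the number (cardinality of the set) of its maximal subsystems. *)

(* Defs.v *)
From HB Require Import structures.
From mathcomp Require Import all_boot all_order all_algebra.
From mathcomp Require Import finmap.

From mathcomp Require Import all_classical all_reals all_analysis.
Set Implicit Arguments.
Unset Strict Implicit.
Unset Printing Implicit Defensive.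
Import Order.TTheory GRing.Theory Num.Theory.
Import numFieldNormedType.Exports.

Local Open Scope classical_set_scope.
Local Open Scope ring_scope.

(* Configurations over all finite alphabets live in the single ambient space of
   integer-valued functions on Z^d; [R] only serves as the codomain of the
   metric, which does not require a common alphabet. *)
Definition config (R : realType) (d : nat) : Type := 'rV[int]_d -> int.

HB.instance Definition _ (R : realType) (d : nat) := Choice.on (config R d).

Definition norm_oo (d : nat) (n : 'rV[int]_d) : nat := \max_(i < d) `|n ord0 i|%N.

Section ConfigMetric.
Context {R : realType} {d : nat}.
Implicit Types x y z : config R d.

Definition differ x y : set 'rV[int]_d := [set n | x n <> y n].

Definition cdist x y : R :=
  if x == y then 0
  else 2 `^ (- inf [set (norm_oo n)%:R | n in differ x y]).

Let lb0 x y : lbound [set ((norm_oo n)%:R : R) | n in differ x y] 0.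
Proof. by move=> _ [n _ <-]. Qed.

Let differ_neq0 x y : x != y -> differ x y !=set0.
Proof.
move=> /eqP xy; apply: contrapT => /set0P/negP/negPn/eqP D0.
apply: xy; apply/funext => n; apply: contrapT => nxy.
by have : differ x y n by []; rewrite D0.
Qed.

Lemma cdist_ge0 x y : 0 <= cdist x y.
Proof. by rewrite /cdist; case: ifP => // _; exact: powR_ge0. Qed.

Lemma cdistxx x : cdist x x = 0.
Proof. by rewrite /cdist eqxx. Qed.

Lemma cdist_eq0 x y : cdist x y = 0 -> x = y.
Proof.
rewrite /cdist; case: eqP => // _ /eqP.
by rewrite gt_eqF// powR_gt0.
Qed.

Lemma cdist_sym x y : cdist x y = cdist y x.
Proof.
suff D : differ x y = differ y x by rewrite /cdist eq_sym D.
by apply/seteqP; split => n /nesym.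
Qed.

Lemma cdist_le1 x y : cdist x y <= 1.
Proof.
rewrite /cdist; case: ifPn => // xy.
rewrite -[leRHS](powRr0 (2 : R)); apply: ler_powR; first by rewrite ler1n.
rewrite oppr_le0; apply: lb_le_inf; last exact: lb0.
by apply: image_nonempty; exact: differ_neq0.
Qed.

Lemma cdist_ultra y x z : cdist x z <= Num.max (cdist x y) (cdist y z).
Proof.
have [->|xy] := eqVneq x y; first by rewrite cdistxx le_max lexx orbT.
have [->|yz] := eqVneq y z; first by rewrite cdistxx le_max lexx.
have [->|xz] := eqVneq x z; first by rewrite cdistxx le_max cdist_ge0.
rewrite /cdist (negbTE xy) (negbTE yz) (negbTE xz).
set a := inf _; set b := inf _; set c := inf _.
have abc : Num.min b c <= a.
  apply: lb_le_inf; first by apply: image_nonempty; exact: differ_neq0.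
  move=> _ [n nxz <-]; rewrite ge_min.
  have [nxy|nxy] := pselect (x n = y n).
    apply/orP; right; apply: ge_inf; first by exists 0; exact: lb0.
    by exists n => //; rewrite /differ /= -nxy.
  apply/orP; left; apply: ge_inf; first by exists 0; exact: lb0.
  by exists n.
have m2 (s t : R) : s <= t -> 2 `^ (- t) <= 2 `^ (- s) :> R.
  by move=> st; apply: ler_powR; rewrite ?ler1n// lerN2.
by rewrite le_max; move: abc; rewrite ge_min => /orP[] /m2 ->; rewrite ?orbT.
Qed.

Lemma cdist_triangle y x z : cdist x z <= cdist x y + cdist y z.
Proof.
apply: (le_trans (cdist_ultra y x z)).
by rewrite ge_max lerDl lerDr !cdist_ge0.
Qed.

End ConfigMetric.

HB.instance Definition _ (R : realType) (d : nat) :=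
  @isMetric.Build R (config R d) cdist cdistxx cdist_eq0 cdist_sym
    cdist_triangle.

Section Shifts.
Context {R : realType} {d : nat}.
Implicit Types (x : config R d) (X Y Z : set (config R d)).

Definition sigma (u : 'rV[int]_d) x : config R d := fun v => x (u + v).

Definition orbit_of x : set (config R d) := [set sigma u x | u in setT].

Definition over_alphabet (A : {fset int}) : set (config R d) :=
  [set x | forall n, x n \in A].

Definition shift_invariant X := forall u, sigma u @` X `<=` X.

Definition is_shift X :=
  [/\ X !=set0, compact X, exists A, X `<=` over_alphabet A
    & shift_invariant X].

(* Only used for A `<=` X. *)
Definition dense_in X (A : set (config R d)) := X `<=` closure A.

(* A finite pattern is a finite partial function from Z^d to Z. *)
Definition appears (p : {fmap 'rV[int]_d -> int}) x :=
  exists u, forall n, n \in domf p -> p.[? n]%fmap = Some (x (u + n)).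

Definition finite_type X :=
  exists (A : {fset int}) (F : {fset {fmap 'rV[int]_d -> int}}),
    X = [set x | over_alphabet A x /\ forall p, p \in F -> ~ appears p x].

Definition topologically_transitive X :=
  exists2 x, X x & dense_in X (orbit_of x).

(* For X compact, closed in X is the same as closed in the ambient space. *)
Definition subsystem X Y :=
  [/\ Y !=set0, closed Y, shift_invariant Y & Y `<=` X].

Definition proper_subsystem X Y := subsystem X Y /\ Y <> X.

Definition minimal X := forall Y, ~ proper_subsystem X Y.

Definition maximal_subsystem X Y :=
  proper_subsystem X Y /\
  forall Z, proper_subsystem X Z -> Y `<=` Z -> Z = Y.

Definition has_maximality_type X (k : nat) : Prop :=
  (maximal_subsystem X #= `I_k)%card.

End Shifts.

Record shift_space (R : realType) (d : nat) := ShiftSpace {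
  shift_set :> set (config R d);
  shift_setP : is_shift shift_set
}.

HB.instance Definition _ (R : realType) (d : nat) :=
  gen_eqMixin (shift_space R d).
HB.instance Definition _ (R : realType) (d : nat) :=
  gen_choiceMixin (shift_space R d).

Section HausdorffMetric.
Context {R : realType} {d : nat}.
Implicit Types (x : config R d) (X Y Z : shift_space R d).

Definition dist_to x (Z : set (config R d)) : R := inf [set cdist x z | z in Z].

Definition excess (X Z : set (config R d)) : R := sup [set dist_to x Z | x in X].

Definition hdist X Z : R := Num.max (excess X Z) (excess Z X).

Let Xn0 X : (X : set (config R d)) !=set0.
Proof. by have [] := shift_setP X. Qed.

Let dist_to_le x Z z : (Z : set _) z -> dist_to x Z <= cdist x z.
Proof.
by move=> Zz; apply: ge_inf; [exists 0 => _ [t _ <-]; exact: cdist_ge0|exists z].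
Qed.

Let dist_to_ge x Z (a : R) :
  (forall z, (Z : set _) z -> a <= cdist x z) -> a <= dist_to x Z.
Proof.
move=> H; apply: lb_le_inf; first exact: image_nonempty.
by move=> _ [z Zz <-]; exact: H.
Qed.

Let dist_to_ge0 x Z : 0 <= dist_to x Z.
Proof. by apply: dist_to_ge => z _; exact: cdist_ge0. Qed.

Let excess_ub X Z x : (X : set _) x -> dist_to x Z <= excess X Z.
Proof.
move=> Xx; apply: ub_le_sup; last by exists x.
exists 1 => _ [t _ <-]; have [z Zz] := Xn0 Z.
exact: le_trans (dist_to_le t Zz) (cdist_le1 _ _).
Qed.

Let excess_le X Z (a : R) :
  (forall x, (X : set _) x -> dist_to x Z <= a) -> excess X Z <= a.
Proof.
move=> H; apply: ge_sup; first exact: image_nonempty.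
by move=> _ [z Zz <-]; exact: H.
Qed.

Let excess_ge0 X Z : 0 <= excess X Z.
Proof. by have [x Xx] := Xn0 X; exact: le_trans (excess_ub Z Xx). Qed.

Let excess_triangle Y X Z : excess X Z <= excess X Y + excess Y Z.
Proof.
apply: excess_le => x Xx; apply: (@le_trans _ _ (dist_to x Y + excess Y Z)).
  rewrite -lerBlDr; apply: dist_to_ge => y Yy; rewrite lerBlDr.
  apply: (@le_trans _ _ (cdist x y + dist_to y Z)); last first.
    by rewrite lerD2l; exact: excess_ub.
  rewrite -lerBlDl; apply: dist_to_ge => z Zz; rewrite lerBlDl.
  exact: le_trans (dist_to_le x Zz) (cdist_triangle _ _ _).
by rewrite lerD2r; exact: excess_ub.
Qed.

Let excess0_sub X Z : excess X Z = 0 -> X `<=` Z.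
Proof.
move=> XZ0 x Xx; have [_ cZ _ _] := shift_setP Z.
have : closed (Z : set (config R d)).
  exact: compact_closed (@metric_hausdorff R (config R d)) cZ.
apply => B /nbhs_ballP[e /= e0 Be].
have dx0 : dist_to x Z = 0.
  by apply/eqP; rewrite eq_le dist_to_ge0 andbT -XZ0; exact: excess_ub.
have [z Zz xz] : exists2 z, (Z : set _) z & cdist x z < e.
  apply: contrapT => H; suff : e <= dist_to x Z by rewrite dx0 leNgt e0.
  by apply: dist_to_ge => z Zz; rewrite leNgt; apply/negP => ze; apply: H; exists z.
by exists z; split => //; apply: Be; rewrite ballEmdist.
Qed.

Lemma hdistxx X : hdist X X = 0.
Proof.
rewrite /hdist maxxx; apply/eqP; rewrite eq_le excess_ge0 andbT.
by apply: excess_le => x Xx; rewrite -(cdistxx x); exact: dist_to_le.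
Qed.

Lemma hdist_eq0 X Z : hdist X Z = 0 -> X = Z.
Proof.
move=> h0.
have XZ : excess X Z = 0.
  by apply/eqP; rewrite eq_le excess_ge0 andbT -h0 /hdist le_max lexx.
have ZX : excess Z X = 0.
  by apply/eqP; rewrite eq_le excess_ge0 andbT -h0 /hdist le_max lexx orbT.
have : X = Z :> set _ by apply/seteqP; split; exact: excess0_sub.
case: X Z {h0 XZ ZX} => [X pX] [Z pZ] /= XZ; rewrite XZ in pX *.
by rewrite (Prop_irrelevance pX pZ).
Qed.

Lemma hdist_sym X Z : hdist X Z = hdist Z X.
Proof. by rewrite /hdist maxC. Qed.

Lemma hdist_triangle Y X Z : hdist X Z <= hdist X Y + hdist Y Z.
Proof.
rewrite {1}/hdist ge_max; apply/andP; split.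
  by apply: le_trans (excess_triangle Y X Z) _; rewrite lerD// le_max lexx.
apply: le_trans (excess_triangle Y Z X) _.
by rewrite addrC lerD// le_max lexx orbT.
Qed.

End HausdorffMetric.

HB.instance Definition _ (R : realType) (d : nat) :=
  @isMetric.Build R (shift_space R d) hdist hdistxx hdist_eq0 hdist_sym
    hdist_triangle.

Definition transitive_shifts (R : realType) (d : nat) : set (shift_space R d) :=
  [set X | topologically_transitive X].
Arguments transitive_shifts : clear implicits.

(* Main.v *)
(* The Hausdorff distance of two shifts is small exactly when they share the same
   patterns on a large box.  A shift whose patterns on a large enough box all
   occur in a shift of finite type Z is contained in Z.  If X is transitive with a
   maximal subsystem M, then M contains every proper subsystem, so a subsystem of
   X showing a pattern of X that is absent from M equals X.  Both sufficient
   conditions follow: they force every transitive Y close to X to lie inside X.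
   Conversely, let Z_n be the finite type shift of all configurations whose
   n-boxes occur in X.  Were Z_n \ X dense in Z_n for every n, some z in Z_n \ X
   would agree with a transitive point of X on a box showing all n-patterns of X,
   and the orbit closures of these z would be transitive shifts distinct from X
   converging to X. *)
Require Import Defs.
From mathcomp Require Import all_boot all_order all_algebra.
From mathcomp Require Import finmap.
From mathcomp Require Import all_classical all_reals all_analysis.
From mathcomp Require Import zify.

Local Open Scope classical_set_scope.

Section Windows.
Set Implicit Arguments.
Unset Strict Implicit.
Import Order.TTheory GRing.Theory Num.Theory.
Local Open Scope ring_scope.
Context {R : realType} {d : nat}.
Implicit Types (x y z : config R d) (u v w : 'rV[int]_d) (n : nat)
  (X Y Z S : set (config R d)).

(** * Boxes in Z^d and the topology of the configuration space *)

Lemma norm_ooD u v : (norm_oo (u + v) <= norm_oo u + norm_oo v)%N.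
Proof.
apply/bigmax_leqP => i _; rewrite mxE.
have abszD (a b : int) : (`|(a + b)%R| <= `|a| + `|b|)%N by lia.
apply: leq_trans (abszD _ _) _; apply: leq_add.
  exact: (@leq_bigmax _ (fun i => `|u ord0 i|%N)).
exact: (@leq_bigmax _ (fun i => `|v ord0 i|%N)).
Qed.

Lemma norm_oo0 : norm_oo (0 : 'rV[int]_d) = 0%N.
Proof. by apply/eqP; rewrite -leqn0; apply/bigmax_leqP => i _; rewrite mxE. Qed.

Lemma finite_box n : finite_set [set v : 'rV[int]_d | (norm_oo v <= n)%N].
Proof.
pose f (g : 'rV['I_(n.*2.+1)]_d) : 'rV[int]_d :=
  map_mx (fun k : 'I_(n.*2.+1) => k%:Z - n%:Z) g.
apply: (@sub_finite_set _ _ (f @` setT)); last first.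
  by apply: finite_image; exact: finite_finset.
move=> v /= /bigmax_leqP vn.
exists (\row_i inord `|(v ord0 i + n%:Z)%R|%N) => //.
have lt_n (a : int) : (`|a| <= n -> `|(a + n%:Z)%R| < n.*2.+1)%N by lia.
have shiftK (a : int) : (`|a| <= n)%N -> (`|(a + n%:Z)%R|%N : int) - n%:Z = a by lia.
by apply/rowP => i; rewrite !mxE inordK ?shiftK ?lt_n ?vn.
Qed.

Definition box n : {fset 'rV[int]_d} :=
  fset_set [set v : 'rV[int]_d | (norm_oo v <= n)%N].

Lemma in_box n v : (v \in box n) = (norm_oo v <= n)%N.
Proof.
by rewrite in_fset_set; [apply/idP/idP => [/set_mem//|/mem_set]|exact: finite_box].
Qed.

Lemma subset_box (B : {fset 'rV[int]_d}) :
  exists n, forall v, v \in B -> (norm_oo v <= n)%N.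
Proof.
exists (\max_(v : B) norm_oo (val v)) => v vB.
exact: (@leq_bigmax _ (fun v : B => norm_oo (val v)) [` vB]%fset).
Qed.

Definition agree n x y := forall v, (norm_oo v <= n)%N -> x v = y v.

Lemma agree_trans n y x z : agree n x y -> agree n y z -> agree n x z.
Proof. by move=> xy yz v vn; rewrite xy// yz. Qed.

Lemma agreeW m n x y : (m <= n)%N -> agree n x y -> agree m x y.
Proof. by move=> mn xy v vm; apply: xy; exact: leq_trans mn. Qed.

Lemma agree_at x y v : agree (norm_oo v) x y -> x v = y v.
Proof. exact. Qed.

Lemma sigmaD u v x : sigma u (sigma v x) = sigma (v + u) x.
Proof. by apply/funext => w; rewrite /sigma addrA. Qed.

Lemma sigma0 x : sigma 0 x = x.
Proof. by apply/funext => w; rewrite /sigma add0r. Qed.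

Lemma agree_sigma n u x y :
  agree (norm_oo u + n) x y -> agree n (sigma u x) (sigma u y).
Proof.
move=> xy v vn; apply: xy; apply: leq_trans (norm_ooD _ _) _.
by rewrite leq_add2l.
Qed.

Lemma cdist_lt_agree n x y : cdist x y < 2 `^ (- n%:R) <-> agree n x y.
Proof.
rewrite /cdist; split.
  case: eqP => [->//|_].
  rewrite ltNge => + v vn; apply: contraNeq => /eqP xyv.
  apply: ler_powR; rewrite ?ler1n// lerN2.
  apply: (@le_trans _ _ (norm_oo v)%:R); last by rewrite ler_nat.
  by apply: ge_inf; [exists 0 => _ [t _ <-]|exists v].
move=> xy; case: ifPn => [_|xney]; first exact: powR_gt0.
(* Norms are natural numbers, so a disagreement outside the box has norm at least [n.+1]; this gap
   makes the inequality strict. *)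
apply: (@le_lt_trans _ _ (2 `^ (- n.+1%:R))).
  apply: ler_powR; rewrite ?ler1n// lerN2; apply: lb_le_inf.
    apply: image_nonempty; apply: contrapT => /set0P/negP/negPn/eqP D0.
    move/eqP: xney; apply; apply/funext => v; apply: contrapT => xyv.
    by have : differ x y v by []; rewrite D0.
  move=> _ [v xyv <-]; rewrite ler_nat ltnNge; apply/negP => vn.
  exact: xyv (xy v vn).
rewrite !powRN !powR_mulrn// ltf_pV2 ?posrE ?exprn_gt0//.
by rewrite ltr_eXn2l// ltr1n.
Qed.

Lemma pow2N_lt (e : R) : 0 < e -> exists n, 2 `^ (- n%:R) < e.
Proof.
move=> e0; have [n _ /(_ n (leqnn n))] := near_infty_natSinv_expn_lt (PosNum e0).
by move=> ne; exists n; rewrite powRN powR_mulrn// -div1r.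
Qed.

Lemma ballP n x y : ball x (2 `^ (- n%:R)) y <-> agree n x y.
Proof. by rewrite ballEmdist /=; exact: cdist_lt_agree. Qed.

Lemma nbhs_agreeP x (U : set (config R d)) :
  nbhs x U <-> exists n, agree n x `<=` U.
Proof.
split.
  case/nbhs_ballP => e /= /pow2N_lt[n ne] eU; exists n => y /ballP nxy.
  by apply: eU; exact: le_ball (ltW ne) _ nxy.
case=> n nU; apply/nbhs_ballP; exists (2 `^ (- n%:R)); first exact: powR_gt0.
by move=> y /ballP/nU.
Qed.

Lemma closureP S x : closure S x <-> forall n, exists2 y, S y & agree n x y.
Proof.
split=> [Sx n|Sx U /nbhs_agreeP[n nU]].
  have [|y [Sy xy]] := Sx (agree n x); last by exists y.
  by apply/nbhs_agreeP; exists n.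
by have [y Sy /nU] := Sx n; exists y.
Qed.

Lemma closedP S :
  closed S <-> forall x, (forall n, exists2 y, S y & agree n x y) -> S x.
Proof. by split=> cS x => [/closureP/cS|/closureP/cS]. Qed.

(** As [A] is finite, an ultrafilter selects one value at each coordinate. These values form its
    limit, since a basic neighbourhood constrains only the finitely many coordinates of a box. *)
Lemma compact_over_alphabet (A : {fset int}) :
  compact (over_alphabet A : set (config R d)).
Proof.
rewrite compact_ultra => F UF FA.
have val v : exists a, a \in A /\ F [set x : config R d | x v = a].
  apply: contrapT => /forallNP Fv.
  have FN : F (\bigcap_(a in [set` A]) ~` [set x : config R d | x v = a]).
    apply: filter_bigI => a aA.
    by have [Fa|//] := in_ultra_setVsetC [set x : config R d | x v = a] UF;
      case: (Fv a).
  have [x [Ax]] := filter_ex (filterI FA FN).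
  by move=> /(_ (x v) (Ax v)); exact.
have [x Fx] := choice val.
exists x; split=> [v|U /nbhs_agreeP[n nU]]; first by have [] := Fx v.
apply: filterS nU _.
apply: (@filterS _ F _ (\bigcap_(v in [set` box n]) [set y : config R d | y v = x v])).
  by move=> y yx v; rewrite -in_box => /yx.
by apply: filter_bigI => v _; have [] := Fx v.
Qed.

Lemma is_shift_closed X : is_shift X -> closed X.
Proof.
by case=> _ cX _ _; exact: compact_closed (@metric_hausdorff R (config R d)) cX.
Qed.

(** The form in which new shifts are built: a closed set inside the compact [over_alphabet A] is
    compact. *)
Lemma is_shiftP X : is_shift X <->
  [/\ X !=set0, closed X, exists A, X `<=` over_alphabet A & shift_invariant X].
Proof.
split=> [sX|[X0 cX [A XA] sX]].
  by have := is_shift_closed sX; case: sX.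
by split=> //; [exact: subclosed_compact cX (@compact_over_alphabet A) XA|exists A].
Qed.

Lemma shift_invariantP X u x : shift_invariant X -> X x -> X (sigma u x).
Proof. by move=> sX Xx; apply: sX; exists x. Qed.

Lemma over_alphabet_sigma (A : {fset int}) u x :
  over_alphabet A x -> over_alphabet A (sigma u x).
Proof. by move=> Ax v; exact: Ax. Qed.

(** Only boxes centred at the origin are compared; for shift-invariant sets this covers the boxes at
    every position. *)
Definition windows_in n X Y := forall x, X x -> exists2 y, Y y & agree n x y.

Lemma windows_inW m n X Y : (m <= n)%N -> windows_in n X Y -> windows_in m X Y.
Proof. by move=> mn XY x /XY[y Yy /(agreeW mn)]; exists y. Qed.

Lemma sub_windows_in n X Y : X `<=` Y -> windows_in n X Y.
Proof. by move=> XY x /XY; exists x. Qed.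

Lemma windows_in_trans n Y X Z :
  windows_in n X Y -> windows_in n Y Z -> windows_in n X Z.
Proof.
by move=> XY YZ x /XY[y /YZ[z Zz yz] xy]; exists z => //; exact: agree_trans yz.
Qed.

Lemma orbit_closure_invariant x : shift_invariant (closure (orbit_of x)).
Proof.
move=> u _ [y /closureP xy <-]; apply/closureP => n.
have [_ [w _ <-] /agree_sigma yw] := xy (norm_oo u + n)%N.
by exists (sigma u (sigma w x)) => //; exists (w + u) => //; rewrite sigmaD.
Qed.

Lemma orbit_closure_sub x Y : closed Y -> shift_invariant Y -> Y x ->
  closure (orbit_of x) `<=` Y.
Proof.
move=> cY sY Yx y xy; apply: cY => U /xy[_ [[u _ <-] Ux]].
by exists (sigma u x); split => //; exact: shift_invariantP.
Qed.

Lemma orbit_of_self x : orbit_of x x.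
Proof. by exists 0 => //; rewrite sigma0. Qed.

Lemma orbit_closure_transitive x : topologically_transitive (closure (orbit_of x)).
Proof. by exists x => //; apply: subset_closure; exact: orbit_of_self. Qed.


(** The finitely many forbidden patterns have supports in a common box, so their absence can be
    checked on windows of that radius, moved to the origin by shift invariance. *)
Lemma finite_type_windows Z : finite_type Z ->
  exists n, forall Y, shift_invariant Y -> windows_in n Y Z -> Y `<=` Z.
Proof.
move=> [A [F ZE]].
have [n nF] := subset_box (\bigcup_(p <- F) domf p)%fset.
exists n => Y sY YZ y Yy; rewrite ZE; split=> [v|p pF [u pu]].
  (* The symbol of [y] at [v] is the symbol of the shifted point at 0, which lies in every box. *)
  have [z + yz] := YZ _ (shift_invariantP v sY Yy); rewrite ZE => -[/(_ 0) Az _].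
  by rewrite -[v]addr0 -[y _]/(sigma v y 0) yz ?norm_oo0.
have [z + yz] := YZ _ (shift_invariantP u sY Yy).
rewrite ZE => -[_ /(_ p pF)]; apply; exists 0 => v vp; rewrite pu// add0r.
congr Some; apply: yz; apply: nF; apply/bigfcupP; exists p => //.
by rewrite pF.
Qed.

(** * Outer approximations by shifts of finite type *)

Definition sft_cover (A : {fset int}) n X : set (config R d) :=
  [set x | over_alphabet A x /\ forall u, exists2 y, X y & agree n (sigma u x) y].

Definition window n x : {fmap 'rV[int]_d -> int} :=
  [fmap v : box n => x (val v)]%fmap.

Lemma finite_windows (A : {fset int}) n :
  finite_set [set window n x | x in over_alphabet A].
Proof.
pose f (g : {ffun box n -> A}) : {fmap 'rV[int]_d -> int} :=
  [fmap v : box n => val (g v)]%fmap.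
apply: (@sub_finite_set _ _ (f @` setT)); last first.
  by apply: finite_image; exact: finite_finset.
move=> _ [x Ax <-]; exists [ffun v : box n => [` Ax (val v)]%fset] => //.
by congr (FinMap _); apply/ffunP => v; rewrite !ffunE.
Qed.

Lemma windowE n x v : (norm_oo v <= n)%N -> (window n x).[? v]%fmap = Some (x v).
Proof. by rewrite -in_box => vn; rewrite in_fnd /window ffunE. Qed.

Lemma window_eq_agree n x y : window n x = window n y -> agree n x y.
Proof. by move=> xy v vn; have := windowE x vn; rewrite xy windowE// => -[]. Qed.

Lemma appears_window n f x :
  appears (window n f) x <-> exists u, agree n f (sigma u x).
Proof.
split=> -[u fu]; exists u => v.
  by move=> vn; have := fu v; rewrite in_box vn windowE// => /(_ isT) [].
by rewrite in_box => vn; rewrite windowE// fu.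
Qed.

(** Only finitely many [n]-windows occur in [X], and the dense orbit of [x] shows each of them, so
    one large box of [x] contains a copy of all. *)
Lemma transitive_windows (A : {fset int}) n X x :
  X `<=` over_alphabet A -> X `<=` closure (orbit_of x) ->
  exists m, forall y, agree m x y -> windows_in n X (orbit_of y).
Proof.
move=> XA Xx.
have finP : finite_set [set window n z | z in X].
  by apply: sub_finite_set (finite_windows A n) => _ [z /XA Az <-]; exists z.
have seen p : exists m, forall z y, X z -> window n z = p -> agree m x y ->
    exists2 t, orbit_of y t & agree n z t.
  have [[z [Xz zp]]|NE] := pselect (exists z, X z /\ window n z = p); last first.
    by exists 0%N => z y Xz zp; case: NE; exists z.
  have [_ [u _ <-] zu] := (closureP _ _).1 (Xx z Xz) n.
  (* The copy of [p] sits at position [u] in [x], so this radius contains all of it. *)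
  exists (norm_oo u + n)%N => z' y _ z'p /agree_sigma xy.
  exists (sigma u y); first by exists u.
  by apply: agree_trans xy; apply: agree_trans zu; apply: window_eq_agree; rewrite zp.
have [f fP] := choice seen.
pose P := fset_set [set window n z | z in X].
exists (\max_(p : P) f (val p)) => y xy z Xz.
have zP : window n z \in P by rewrite in_fset_set//; apply/mem_set; exists z.
apply: (fP _ z y Xz erefl); apply: agreeW xy.
exact: (@leq_bigmax _ (fun p : P => f (val p)) [` zP]%fset).
Qed.

(** The forbidden patterns are the [n]-windows over [A] shown by no point of [X]; they are finite in
    number. *)
Lemma sft_cover_finite_type A n X : finite_type (sft_cover A n X).
Proof.
pose G := [set f : config R d | over_alphabet A f /\ forall y, X y -> ~ agree n f y].
have finG : finite_set (window n @` G).
  by apply: sub_finite_set (finite_windows A n) => _ [f [Af _] <-]; exists f.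
exists A, (fset_set (window n @` G)); apply/seteqP; split=> x [Ax xX].
  split=> // p; rewrite in_fset_set// => /set_mem[f [Af Xf] <-].
  move=> /appears_window[u fx]; have [y Xy xy] := xX u.
  exact: Xf Xy (agree_trans fx xy).
split=> // u; apply: contrapT => Nu; apply: (xX (window n (sigma u x))).
  rewrite in_fset_set//; apply/mem_set; exists (sigma u x) => //.
  split=> [|y Xy xy]; first exact: over_alphabet_sigma.
  by apply: Nu; exists y.
by apply/appears_window; exists u.
Qed.

Lemma sub_sft_cover A n X : X `<=` over_alphabet A -> shift_invariant X ->
  X `<=` sft_cover A n X.
Proof.
move=> XA sX x Xx; split=> [|u]; first exact: XA.
by exists (sigma u x) => //; exact: shift_invariantP.
Qed.

Lemma sft_cover_invariant A n X : shift_invariant (sft_cover A n X).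
Proof.
move=> u _ [x [Ax xX] <-]; split=> [|v]; first exact: over_alphabet_sigma.
by rewrite sigmaD.
Qed.

Lemma sft_cover_closed A n X : closed (sft_cover A n X).
Proof.
apply/closedP => x xX; split=> [v|u].
  by have [y [Ay _] xy] := xX (norm_oo v); rewrite (agree_at xy).
have [y [_ yX] /agree_sigma xy] := xX (norm_oo u + n)%N.
by have [z Xz yz] := yX u; exists z => //; exact: agree_trans yz.
Qed.

Lemma sft_cover_windows A n X : windows_in n (sft_cover A n X) X.
Proof. by move=> x [_ /(_ 0)]; rewrite sigma0. Qed.

Lemma sft_cover_is_shift A n X :
  is_shift X -> X `<=` over_alphabet A -> is_shift (sft_cover A n X).
Proof.
move=> [[x Xx] _ _ sX] XA; apply/is_shiftP; split.
- by exists x; exact: sub_sft_cover.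
- exact: sft_cover_closed.
- by exists A => y [].
- exact: sft_cover_invariant.
Qed.

(* [M `|` Y] is a subsystem containing [M]; it is not [X], since a point with
   dense orbit in [X] would lie in [M] or in [Y]. *)
Lemma proper_sub_maximal X M Y : topologically_transitive X ->
  maximal_subsystem X M -> proper_subsystem X Y -> Y `<=` M.
Proof.
move=> [x Xx dx] [[[[m Mm] cM sM MX] MneX] maxM] [[_ cY sY YX] YneX].
rewrite -[M](maxM (M `|` Y)); [exact: subsetUr| |exact: subsetUl].
split.
  split; [by exists m; left|exact: closedU| |by rewrite subUset].
  by move=> u _ [y [My|Yy] <-]; [left|right]; exact: shift_invariantP.
move=> MYX; have : (M `|` Y) x by rewrite MYX.
case=> [Mx|Yx].
  by apply: MneX; apply/seteqP; split=> // y /dx; exact: orbit_closure_sub.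
by apply: YneX; apply/seteqP; split=> // y /dx; exact: orbit_closure_sub.
Qed.

(** A point [x] of [X] outside the closed set [M] has a window absent from [M]. A proper subsystem
    lies in [M] and cannot show it. If [X] is minimal, radius 0 does. *)
Lemma maximal_windows X : topologically_transitive X -> closed X ->
  (exists M, maximal_subsystem X M) \/ minimal X ->
  exists n, forall Y, subsystem X Y -> windows_in n X Y -> Y = X.
Proof.
move=> tX cX [[M mM]|mX]; last first.
  by exists 0%N => Y sY _; apply: contrapT => YX; exact: (mX Y).
have [[[_ cM _ MX] MneX] _] := mM.
have [x Xx Mx] : exists2 x, X x & ~ M x.
  apply: contrapT => NE; apply: MneX; apply/seteqP; split=> // x Xx.
  by apply: contrapT => Mx; apply: NE; exists x.
have [n nM] : exists n, forall y, agree n x y -> ~ M y.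
  apply: contrapT => NE; apply: Mx; move/closedP: cM; apply => n.
  apply: contrapT => NE2; apply: NE; exists n => y xy My.
  by apply: NE2; exists y.
exists n => Y sY XY; apply: contrapT => YX.
have [y Yy /nM] := XY x Xx; apply.
exact: (proper_sub_maximal tX mM) Yy.
Qed.

End Windows.

(** * The Hausdorff metric read off from windows *)

Section Hausdorff.
Set Implicit Arguments.
Unset Strict Implicit.
Import Order.TTheory GRing.Theory Num.Theory.
Local Open Scope ring_scope.
Context {R : realType} {d : nat}.
Implicit Types X Y Z : shift_space R d.

Lemma shift_space_eq X Y : X = Y :> set (config R d) -> X = Y.
Proof.
case: X Y => [X pX] [Y pY] /= XY; rewrite XY in pX *.
by rewrite (Prop_irrelevance pX pY).
Qed.

Lemma excess_lt_windows n X Y :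
  excess X Y < 2 `^ (- n%:R) -> windows_in n X Y.
Proof.
move=> XYn x Xx.
have [[y0 Yy0] _ _ _] := shift_setP Y.
have dle z t : (Y : set _) t -> dist_to z Y <= cdist z t.
  by move=> Yt; apply: ge_inf; [exists 0 => _ [? _ <-]; exact: cdist_ge0|exists t].
have : dist_to x Y < 2 `^ (- n%:R).
  apply: le_lt_trans XYn; apply: ub_le_sup; last by exists x.
  by exists 1 => _ [z _ <-]; exact: le_trans (dle z y0 Yy0) (cdist_le1 _ _).
move/inf_lt => /(_ (image_nonempty _ (ex_intro _ _ Yy0)))[_ [y Yy <-]].
by move=> /cdist_lt_agree; exists y.
Qed.

(** Passing to the supremum is done with the weak inequality; strictness is regained later by taking
    [n] with 2^-n below the radius of the ball. *)
Lemma windows_excess_le n X Y :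
  windows_in n X Y -> excess X Y <= 2 `^ (- n%:R).
Proof.
move=> XY; have [X0 _ _ _] := shift_setP X.
apply: ge_sup; first exact: image_nonempty.
move=> _ [x Xx <-]; have [y Yy xy] := XY x Xx.
apply: (@le_trans _ _ (cdist x y)); last by apply/ltW/cdist_lt_agree.
by apply: ge_inf; [exists 0 => _ [? _ <-]; exact: cdist_ge0|exists y].
Qed.

Lemma nbhs_windowsP X (U : set (shift_space R d)) :
  nbhs X U <->
  exists n, forall Y, windows_in n X Y -> windows_in n Y X -> U Y.
Proof.
split.
  case/nbhs_ballP => e /= /pow2N_lt[n ne] eU; exists n => Y XY YX; apply: eU.
  rewrite ballEmdist /=; apply: le_lt_trans ne.
  by rewrite /mdist /= /hdist ge_max !windows_excess_le.
case=> n nU; apply/nbhs_ballP; exists (2 `^ (- n%:R)); first exact: powR_gt0.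
move=> Y; rewrite ballEmdist /= /hdist gt_max => /andP[XY YX].
by apply: nU; exact: excess_lt_windows.
Qed.

Lemma isolatedP (T : set (shift_space R d)) X : T X ->
  isolated T X <-> exists n, forall Y, T Y ->
    windows_in n X Y -> windows_in n Y X -> Y = X :> set (config R d).
Proof.
move=> TX; split=> [[_ [V /nbhs_windowsP[n nV] VT]]|[n nX]].
  exists n => Y TY XY YX; have : (V `&` T) Y by split=> //; exact: nV.
  by rewrite VT => ->.
split; first exact: mem_set.
exists [set Y : shift_space R d | windows_in n X Y /\ windows_in n Y X].
  by apply/nbhs_windowsP; exists n.
apply/seteqP; split=> [Y [[XY YX] TY]|_ ->].
  by apply: shift_space_eq; exact: nX.
by split=> //; split; exact: sub_windows_in.
Qed.

End Hausdorff.

Theorem theorem2 (R : realType) (d : nat) (d_ge1 : (1 <= d)%N)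
    (X : shift_space R d) (X_trans : transitive_shifts R d X) :
  (finite_type X -> has_maximality_type X 1 \/ minimal X ->
     isolated (transitive_shifts R d) X)
  /\
  (~ finite_type X -> has_maximality_type X 1 ->
     (isolated (transitive_shifts R d) X <->
      exists Z : shift_space R d,
        [/\ finite_type Z, X `<=` Z & ~ dense_in Z (Z `\` X)])).
Proof.
have [_ _ [A XA] sX] := shift_setP X.
have cX : closed X := is_shift_closed (shift_setP X).
have max1 : has_maximality_type X 1 -> exists M, maximal_subsystem X M.
  rewrite /has_maximality_type => h.
  apply/set0P/negP => /eqP h0; move: h.
  by rewrite h0 card_eq_sym card_eq0 II1 => /eqP/seteqP[/(_ 0%N erefl)].
split=> [/finite_type_windows[n nX] hX|_ hX].
  have [k kX] : exists k, forall Y, subsystem X Y -> windows_in k X Y -> Y = X.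
    by apply: maximal_windows => //; case: hX => [/max1|]; [left|right].
  (* Radius [n] forces [Y] into [X]; radius [k] then forces this subsystem to be all of [X]. *)
  apply/(isolatedP X_trans); exists (maxn n k) => Y _ XY YX.
  have [Y0 _ _ sY] := shift_setP Y.
  apply: kX; last exact: windows_inW (leq_maxr n k) XY.
  split=> //; first exact: is_shift_closed (shift_setP Y).
  by apply: nX => //; exact: windows_inW (leq_maxl n k) YX.
have [k kX] : exists k, forall Y, subsystem X Y -> windows_in k X Y -> Y = X.
  by apply: maximal_windows => //; left; exact: max1.
have [x Xx dx] := X_trans.
split=> [/(isolatedP X_trans)[n nX]|[Z [/finite_type_windows[n nZ] XZ Zd]]].
  exists (ShiftSpace (sft_cover_is_shift n (shift_setP X) XA)).
  split=> /=; [exact: sft_cover_finite_type|exact: sub_sft_cover|].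
  have [m mP] := transitive_windows n XA dx.
  (* Density would give [z] outside [X] agreeing with [x] on the [m]-box. Its orbit closure has the
     same [n]-windows as [X], so isolation identifies it with [X], which then contains [z]. *)
  move=> /(_ x (sub_sft_cover n XA sX Xx))/closureP/(_ m)[z [Zz Xz] xz].
  have Y_shift : is_shift (closure (orbit_of z)).
    apply/is_shiftP; split.
    - by exists z; apply: subset_closure; exact: orbit_of_self.
    - exact: closed_closure.
    - exists A; apply: (@subset_trans _ (sft_cover A n X)); last by move=> y [].
      by apply: orbit_closure_sub => //;
        [exact: sft_cover_closed|exact: sft_cover_invariant].
    - exact: orbit_closure_invariant.
  apply: Xz; rewrite -(nX (ShiftSpace Y_shift)) /=.
  - by apply: subset_closure; exact: orbit_of_self.
  - exact: orbit_closure_transitive.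
  - apply: windows_in_trans (mP z xz) _.
    by apply: sub_windows_in; exact: subset_closure.
  - apply: windows_in_trans (@sft_cover_windows _ _ A n X).
    by apply: sub_windows_in; apply: orbit_closure_sub => //;
      [exact: sft_cover_closed|exact: sft_cover_invariant].
(* Non-density provides a cylinder of [Z] around [z] that lies entirely in [X]. *)
have [z Zz [m zm]] : exists2 z, shift_set Z z & exists m, forall y, shift_set Z y -> agree m z y -> shift_set X y.
  apply: contrapT => NE; apply: Zd => z Zz; apply/closureP => m.
  apply: contrapT => NE2; apply: NE; exists z => //; exists m => y Zy zy.
  by apply: contrapT => Xy; apply: NE2; exists y.
have Xz : shift_set X z by exact: zm.
(* Radius [n] puts [Y] inside [Z], [m] makes [Y] meet the cylinder of [z], and [k] upgrades the
   inclusion in [X] to equality. *)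
apply/(isolatedP X_trans); exists (maxn (maxn n m) k) => Y [y Yy dy] XY YX.
have [Y0 _ _ sY] := shift_setP Y.
have YZ : Y `<=` Z.
  apply: nZ => //; apply: windows_in_trans (sub_windows_in n XZ).
  by apply: windows_inW YX; rewrite -maxnA leq_maxl.
have mle : (m <= maxn (maxn n m) k)%N by rewrite -maxnA maxnCA leq_maxl.
have [t Yt zt] := windows_inW mle XY Xz.
(* The dense orbit of [y] enters the cylinder, so a translate of [y] lies in [X]; shifting back by
   [- u] gives [y] itself. *)
have [_ [u _ <-] tu] := (closureP _ _).1 (dy t Yt) m.
have Xu : shift_set X (sigma u y).
  by apply: zm (agree_trans zt tu); apply: YZ; exact: shift_invariantP.
have Xy : shift_set X y.
  have := shift_invariantP (- u)%R sX Xu.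
  by rewrite sigmaD GRing.subrr sigma0.
apply: kX; last exact: windows_inW (leq_maxr _ _) XY.
split=> //; first exact: is_shift_closed (shift_setP Y).
by apply: subset_trans dy _; exact: orbit_closure_sub.
Qed.
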